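(* Let $X$ be a complex Banach space and let $A,B,C\in L(X)$ be such that $A(BA)^2=ABACA=ACABA=(AC)^2A$. Then $\sigma_D(AC)=\sigma_D(BA)$.
   Context: $L(X)$ denotes the Banach algebra (with identity $I$) of all bounded linear operators from $X$ to itself. For a ring $R$ with identity and $a\in R$, $comm(a)=\{x\in R : xa=ax\}$ and $comm^2(a)=\{x\in R : xy=yx \text{ for all } y\in comm(a)\}$. An element $a\in R$ has a Drazin inverse if there exists $b\in R$ such that $b=bab$, $b\in comm^2(a)$ and $a-a^2b$ is nilpotent. $R^{D}$ is the set of all elements of $R$ that have a Drazin inverse. For $T\in L(X)$, the Drazin spectrum is $\sigma_D(T)=\{\lambda\in\mathbb{C} : \lambda I-T\notin L(X)^{D}\}$. *)

(* Defs.v *)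
From HB Require Import structures.
From mathcomp Require Import all_boot all_order all_algebra.
From mathcomp Require Import complex.
From mathcomp Require Import boolp classical_sets functions reals.
From mathcomp Require Import topology normedtype.

Set Implicit Arguments.
Unset Strict Implicit.
Unset Printing Implicit Defensive.

Import Order.TTheory GRing.Theory Num.Theory.
Import numFieldNormedType.Exports.

Local Open Scope classical_set_scope.
Local Open Scope ring_scope.

Section RingDrazin.
Variable R : pzRingType.
Implicit Types a b x : R.

Definition commutant a : set R := [set x | x * a = a * x].

Definition bicommutant a : set R :=
  [set x | forall y, commutant a y -> x * y = y * x].

Definition nilpotent_elt x : Prop := exists n : nat, x ^+ n = 0.

Definition is_drazin_inverse a b : Prop :=
  [/\ b = b * a * b, bicommutant a b & nilpotent_elt (a - a ^+ 2 * b)].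

Definition drazin_invertible : set R :=
  [set a | exists b, is_drazin_inverse a b].

End RingDrazin.

Section BoundedOperators.
Variables (K : numFieldType) (X : normedModType K).

(* Norms take their values in K. For K = R[i] the order makes M * `|x| real,
   so M is a nonnegative real unless X = 0; see boundedOp_bound. *)
Definition bounded_linear (f : X -> X) : Prop :=
  linear f /\ exists M : K, forall x, `|f x| <= M * `|x|.

Definition bounded_linear_pred : {pred X -> X} :=
  fun f => `[< bounded_linear f >].

Record boundedOp : Type := BoundedOp {
  boundedOp_fun :> X -> X;
  boundedOp_subproof : boundedOp_fun \in bounded_linear_pred }.

HB.instance Definition _ := [isSub for boundedOp_fun].
HB.instance Definition _ := [Choice of boundedOp by <:].

Lemma bounded_linearP (T : boundedOp) : bounded_linear T.
Proof. exact/asboolP/(boundedOp_subproof T). Qed.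

Lemma boundedOp_is_linear (T : boundedOp) : linear T.
Proof. by have [] := bounded_linearP T. Qed.

HB.instance Definition _ (T : boundedOp) :=
  GRing.isLinear.Build K X X *:%R T (boundedOp_is_linear T).

Lemma boundedOp_bound (T : boundedOp) :
  exists2 M : K, 0 <= M & forall x, `|T x| <= M * `|x|.
Proof.
have [_ [M TM]] := bounded_linearP T.
have [[x x0]|X0] := pselect (exists x : X, x != 0).
  exists M => //; have := le_trans (normr_ge0 _) (TM x).
  by rewrite pmulr_lge0 // normr_gt0.
exists 0 => // x; have -> : x = 0.
  by apply: contrapT => /eqP x0; apply: X0; exists x.
by rewrite raddf0 !normr0 mulr0.
Qed.

Lemma boundedOp_eqP (S T : boundedOp) : (forall x, S x = T x) <-> S = T.
Proof. by split=> [ST|->//]; apply/val_inj/funext. Qed.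

Lemma bounded_linear_submod_closed : submod_closed bounded_linear_pred.
Proof.
split=> [|a f g /asboolP[lf [M fM]] /asboolP[lg [N gN]]]; apply/asboolP.
  split=> [k x y|]; first by rewrite /= scaler0 addr0.
  by exists 0 => x; rewrite normr0 mul0r.
split=> [k x y|].
  rewrite -[LHS]/(a *: f (k *: x + y) + g (k *: x + y)).
  rewrite -[RHS]/(k *: (a *: f x + g x) + (a *: f y + g y)).
  by rewrite lf lg !scalerDr !scalerA (mulrC a) addrACA.
exists (`|a| * M + N) => x; rewrite (le_trans (ler_normD _ _))//.
by rewrite mulrDl lerD// normrZ -mulrA ler_wpM2l.
Qed.

HB.instance Definition _ := GRing.isSubmodClosed.Build K (X -> X)
  bounded_linear_pred bounded_linear_submod_closed.
HB.instance Definition _ := [SubChoice_isSubLmodule of boundedOp by <:].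

Lemma bounded_linear_id : idfun \in bounded_linear_pred.
Proof.
by apply/asboolP; split=> [//|]; exists 1 => x; rewrite mul1r.
Qed.

Lemma bounded_linear_comp (S T : boundedOp) :
  (S \o T) \in bounded_linear_pred.
Proof.
apply/asboolP; split=> [k x y /=|]; first by rewrite !linearP.
have [[M M0 SM] [N N0 TN]] := (boundedOp_bound S, boundedOp_bound T).
exists (M * N) => x /=; rewrite (le_trans (SM _))// -mulrA.
by rewrite ler_wpM2l.
Qed.

Definition boundedOp_one : boundedOp := BoundedOp bounded_linear_id.

Definition boundedOp_mul (S T : boundedOp) : boundedOp :=
  BoundedOp (bounded_linear_comp S T).

Lemma boundedOp_mulA : associative boundedOp_mul.
Proof. by move=> S T U; apply/boundedOp_eqP. Qed.

Lemma boundedOp_mul1l : left_id boundedOp_one boundedOp_mul.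
Proof. by move=> T; apply/boundedOp_eqP. Qed.

Lemma boundedOp_mul1r : right_id boundedOp_one boundedOp_mul.
Proof. by move=> T; apply/boundedOp_eqP. Qed.

Lemma boundedOp_mulDl : left_distributive boundedOp_mul +%R.
Proof. by move=> S T U; apply/boundedOp_eqP. Qed.

Lemma boundedOp_mulDr : right_distributive boundedOp_mul +%R.
Proof. by move=> S T U; apply/boundedOp_eqP => x; exact: raddfD. Qed.

(* Only a possibly trivial ring, since X may be the zero space; this is also
   why boundedOp gets no algType structure, which requires 1 != 0. *)
HB.instance Definition _ := GRing.Zmodule_isPzRing.Build boundedOp
  boundedOp_mulA boundedOp_mul1l boundedOp_mul1r
  boundedOp_mulDl boundedOp_mulDr.

Lemma boundedOp_oneE x : (1 : boundedOp) x = x.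
Proof. by []. Qed.

Lemma boundedOp_mulE (S T : boundedOp) x : (S * T) x = S (T x).
Proof. by []. Qed.

Lemma boundedOp_scaleE (k : K) (T : boundedOp) x : (k *: T) x = k *: T x.
Proof. by []. Qed.

Lemma boundedOp_scaleAl (k : K) (S T : boundedOp) : k *: (S * T) = k *: S * T.
Proof. by apply/boundedOp_eqP. Qed.

Lemma boundedOp_scaleAr (k : K) (S T : boundedOp) :
  k *: (S * T) = S * (k *: T).
Proof. by apply/boundedOp_eqP => x; rewrite boundedOp_mulE linearZ. Qed.

Lemma bounded_linear_continuousP (f : {linear X -> X}) :
  bounded_linear f <-> continuous f.
Proof.
split=> [bf|/linear_bounded_continuous/linear_boundedP/pinfty_ex_gt0 [M _ fM]].
  have [M M0 fM] := boundedOp_bound (BoundedOp (introT (asboolP _) bf)).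
  apply/bounded_linear_continuous/linear_boundedP.
  exists M; split=> [|r Mr x]; first exact: ger0_real.
  by rewrite (le_trans (fM x))// ler_wpM2r// ltW.
by split; [exact: linearP|exists M].
Qed.

(* The type of 1 is needed: without it unification looks for an algebra
   structure with 1 != 0. *)
Definition drazin_spectrum (T : boundedOp) : set K :=
  [set lambda : K | ~ drazin_invertible (lambda *: (1 : boundedOp) - T)].

End BoundedOperators.

Arguments boundedOp {K} X.

(* Main.v *)
Require Import Defs.
From HB Require Import structures.
From mathcomp Require Import all_boot all_order all_algebra.
From mathcomp Require Import complex.
From mathcomp Require Import boolp classical_sets functions reals.
From mathcomp Require Import topology normedtype.

Import Order.TTheory GRing.Theory Num.Theory.
Import numFieldNormedType.Exports.

Local Open Scope ring_scope.

(** Apart from a rescaling, the theorem holds in any ring.  Write [y = a c] and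
    [x = b a].  The hypotheses say that in a word [a ? a ? a] each letter [?] may
    be [b] or [c] without changing the value.  Hence the map [z |-> b z a], on multiples of [y^2] that
    commute with [y], turns multiplication by [y] into multiplication by [x] on
    either side ([mul_ba_sandwich], [sandwich_mul_ba]) and satisfies
    [(b z a) (b t a) = b (z (y t)) a] ([sandwichM]); moreover it sends [y^2] to
    [x^3].  So from the third power on, [x] behaves like [y], and Drazin inverses
    are carried over by explicit formulas.

    - At 0 ([drazin_mul_swap]): if [d] is the Drazin inverse of [y], then
      [b d^2 a] is that of [x], as in Cline's formula.
    - At 1 ([drazin_one_sub_mul_swap]): let [d] be the Drazin inverse of
      [s = 1 - y] and [p = 1 - s d] its spectral idempotent.  On the range of [p]
      the element [s] is nilpotent, so [y = 1 - s] has there an inverse [w], and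
      [r = b w a] is the spectral idempotent of [1 - x].  The formal expansion
      [1 + x + x^2 + ... = 1 + x + x^2 + b (y^2 (1 + y + ...)) a]
      suggests the Drazin inverse [(1 + x + x^2) (1 - r) + b (y^2 d) a] of
      [1 - x], in the spirit of Jacobson's lemma.
    - At [l != 0]: [l - a c = l (1 - (l^-1 a) c)], and replacing [a] by [l^-1 a]
      preserves the hypotheses.

    This proves one implication.  The converse is the same implication in the
    opposite ring with [b] and [c] exchanged ([drazin_mul_swap_iff]). *)

(** * Drazin invertible elements of a ring *)

Section DrazinCriterion.
Variable S : pzRingType.
Implicit Types a b t u v : S.

(** If [t] commutes with [a], and [p = a b], then [p = b^m a^m = a^m b^m] for all
    [m > 0] while [a^m (1 - p) = 0] for [m > n], so that
    [p t (1 - p) = b^m t a^m (1 - p) = 0], and symmetrically [(1 - p) t p = 0];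
    thus [t] commutes with [p], and then with [b = p b = b p]. *)
Lemma drazin_inverse_bicommutant a b n :
  a * b = b * a -> b * a * b = b -> a ^+ n * (1 - a * b) = 0 ->
  bicommutant a b.
Proof.
move=> ab bab an t /= ta.
have pp m : (a * b) ^+ m.+1 = a * b.
  by elim: m => [|m IH]; rewrite ?expr1 // exprS IH mulrA -!mulrA (mulrA b) bab.
have ann : a ^+ n.+1 * (1 - a * b) = 0 by rewrite exprS -mulrA an mulr0.
have cpa : GRing.comm (1 - a * b) (a ^+ n.+1).
  apply/commr_sym/commrB; first exact: commr1.
  apply/commr_sym/commrX/commr_sym/commrM => //.
have pE : a * b = b ^+ n.+1 * a ^+ n.+1.
  by rewrite -exprMn_comm // -ab pp.
have pE' : a * b = a ^+ n.+1 * b ^+ n.+1 by rewrite -exprMn_comm // pp.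
have tan : t * a ^+ n.+1 = a ^+ n.+1 * t by apply: commrX.
have pt : a * b * t * (1 - a * b) = 0.
  by rewrite {1}pE -(mulrA _ _ t) -tan -!mulrA ann !mulr0.
have tp : (1 - a * b) * t * (a * b) = 0.
  by rewrite {2}pE' mulrA -(mulrA _ t) tan !mulrA cpa ann !mul0r.
have tpE : a * b * t = t * (a * b).
  move/eqP: pt; rewrite mulrBr mulr1 subr_eq0 => /eqP ->.
  by move/eqP: tp; rewrite !mulrBl mul1r subr_eq0 => /eqP.
rewrite -{1}bab -!mulrA (mulrA a) tpE !mulrA -(mulrA b t a) ta !mulrA.
by rewrite -ab tpE -mulrA ab bab.
Qed.

(** Commutation with [a] alone can replace the bicommutant condition, and the
    nilpotency of [a - a^2 b] becomes an equation linear in [1 - a b]: the form in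
    which Drazin inverses are exhibited below. *)
Lemma drazin_invertibleP a :
  drazin_invertible a <->
  exists b n, [/\ a * b = b * a, b * a * b = b & a ^+ n * (1 - a * b) = 0].
Proof.
have idem b : b * a * b = b -> (1 - a * b) * (1 - a * b) = 1 - a * b.
  move=> bab; rewrite mulrBl mul1r mulrBr mulr1.
  by rewrite mulrA -(mulrA a b a) -(mulrA a) bab subrr subr0.
have expE b n : a * b = b * a -> b * a * b = b ->
    (a - a ^+ 2 * b) ^+ n.+1 = a ^+ n.+1 * (1 - a * b).
  move=> ab bab; have -> : a - a ^+ 2 * b = a * (1 - a * b).
    by rewrite mulrBr mulr1 mulrA expr2.
  have cm : GRing.comm a (1 - a * b).
    by apply: commrB; [exact: commr1|exact: commrM].
  rewrite exprMn_comm //; congr (_ * _).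
  by elim: n => [|n IH]; rewrite ?expr1 // exprS IH idem.
split=> [[b [bab bic [n an]]]|[b [n [ab bab an]]]].
  have ab : a * b = b * a by rewrite bic.
  exists b, n.+1; split=> //.
  by rewrite -expE // exprS an mulr0.
exists b; split=> //; first exact: drazin_inverse_bicommutant an.
by exists n.+1; rewrite expE // exprS -mulrA an mulr0.
Qed.

Lemma drazin_invertible_scale u v a :
  u * v = 1 -> (forall t, u * t = t * u) -> (forall t, v * t = t * v) ->
  drazin_invertible a -> drazin_invertible (u * a).
Proof.
move=> uv cu cv /drazin_invertibleP[d [n [ad dad an]]].
apply/drazin_invertibleP; exists (v * d), n.
have uavd : u * a * (v * d) = a * d.
  by rewrite mulrA -(mulrA u) -(cv a) mulrA uv mul1r.
have vdua : v * d * (u * a) = d * a.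
  by rewrite mulrA -(mulrA v) -(cu d) mulrA -(cu v) uv mul1r.
split; first by rewrite uavd vdua.
  by rewrite vdua cv mulrA dad.
by rewrite uavd exprMn_comm // -mulrA an mulr0.
Qed.

End DrazinCriterion.

Lemma drazin_invertible_converse (S : pzRingType) (a : S) :
  drazin_invertible (a : S^c) <-> drazin_invertible a.
Proof.
have expc n : (a : S^c) ^+ n = (a ^+ n : S).
  by elim: n => [|n IH] //; rewrite exprS IH exprSr.
have swap (d : S) n : a * d = d * a ->
    a ^+ n * (1 - a * d) = (1 - d * a) * a ^+ n.
  move=> ad; rewrite -ad; apply/commr_sym/commrX/commr_sym.
  by apply: commrB; [exact: commr1|exact: commrM].
split=> /drazin_invertibleP[d [n [ad dad an]]];
  apply/drazin_invertibleP; exists d, n; split; rewrite ?expc in an *.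
- exact: (esym ad).
- by rewrite -[RHS]dad; exact: (esym (mulrA (d : S) a d)).
- by rewrite (swap d n (esym ad)); exact: an.
- exact: (esym ad).
- by rewrite -[RHS]dad; exact: (mulrA (d : S) a d).
- by move: an; rewrite (swap d n ad).
Qed.

(** * Transfer of Drazin inverses to [b a] *)

(** The element [y] stands for [a c]; the three equations are instances of the
    exchange of letters in words [a ? a ? a]. *)
Section Transfer.
Variables (S : pzRingType) (a b y : S).
Hypothesis ab_sq : a * b * y ^+ 2 = y ^+ 3.
Hypothesis sq_aba : y ^+ 2 * a * b * a = y ^+ 3 * a.
Hypothesis ba_cube : (b * a) ^+ 3 = b * y ^+ 2 * a.
Local Notation x := (b * a).

Definition sandwich (z : S) : S := b * z * a.

(** The factor [y^2] lets the hypotheses be applied, and commutation with [y]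
    makes it available on both sides. *)
Definition comm_sq_multiple (z : S) : Prop :=
  exists2 z', GRing.comm y z' & z = y ^+ 2 * z'.

Lemma comm_sq_multipleM z t :
  comm_sq_multiple z -> GRing.comm y t -> comm_sq_multiple (z * t).
Proof.
move=> [z' yz' ->] yt; exists (z' * t); first exact: commrM.
by rewrite mulrA.
Qed.

Lemma comm_sq_multiple_comm z : comm_sq_multiple z -> GRing.comm y z.
Proof. by move=> [z' yz' ->]; apply: commrM => //; apply: commrX. Qed.

Lemma comm_sq_multiple_sq : comm_sq_multiple (y ^+ 2).
Proof. by exists 1; [exact: commr1|rewrite mulr1]. Qed.

Lemma mul_ab_sq_multiple z : comm_sq_multiple z -> a * b * z = y * z.
Proof.
by move=> [z' _ ->]; rewrite mulrA ab_sq exprS mulrA.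
Qed.

Lemma sq_multiple_mul_aba z : comm_sq_multiple z -> z * a * b * a = z * y * a.
Proof.
move=> [z' yz' ->]; rewrite (commr_sym (commrX 2 (commr_sym yz'))).
by rewrite -!(mulrA z') sq_aba -exprSr.
Qed.

Lemma sandwichB z t : sandwich (z - t) = sandwich z - sandwich t.
Proof. by rewrite /sandwich mulrBr mulrBl. Qed.

Lemma mul_ba_sandwich z :
  comm_sq_multiple z -> x * sandwich z = sandwich (y * z).
Proof.
by move=> hz; rewrite /sandwich -(mul_ab_sq_multiple _ hz) !mulrA.
Qed.

Lemma sandwich_mul_ba z :
  comm_sq_multiple z -> sandwich z * x = sandwich (y * z).
Proof.
move=> hz; rewrite (comm_sq_multiple_comm _ hz) /sandwich.
by have := sq_multiple_mul_aba _ hz; rewrite -!mulrA => ->.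
Qed.

Lemma sandwichM z t :
  comm_sq_multiple t -> sandwich z * sandwich t = sandwich (z * (y * t)).
Proof.
by move=> ht; rewrite /sandwich -(mul_ab_sq_multiple _ ht) !mulrA.
Qed.

(** The Drazin inverse [d] of [y] is a multiple of [y^2], because
    [d = y^2 d^3]; so [b d^2 a] behaves towards [x] as [y d^2 = d] suggests. *)
Lemma drazin_mul_swap : drazin_invertible y -> drazin_invertible x.
Proof.
move=> /drazin_invertibleP[d [n [yd dyd yn]]].
have ydd : y * d * d = d by rewrite yd.
have hd : comm_sq_multiple d.
  exists (d ^+ 3); first by apply: commrX.
  by rewrite !exprS !expr0 !mulr1 -!mulrA (mulrA y d) (mulrA (y * d)) ydd mulrA ydd.
have hdd : comm_sq_multiple (d * d) by apply: comm_sq_multipleM.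
have xb : x * sandwich (d * d) = sandwich d.
  by rewrite mul_ba_sandwich // mulrA yd dyd.
have bx : sandwich (d * d) * x = sandwich d.
  by rewrite sandwich_mul_ba // mulrA yd dyd.
have xn m : x ^+ m.+3 = sandwich (y ^+ m.+2).
  elim: m => [|m IH]; first exact: ba_cube.
  rewrite exprS IH (exprD y 2 m) mul_ba_sandwich -?exprD -?exprS //.
  by rewrite (exprD y 2 m); apply: comm_sq_multipleM;
    [exact: comm_sq_multiple_sq|exact: commrX].
apply/drazin_invertibleP; exists (sandwich (d * d)), n.+3; split.
- by rewrite xb bx.
- by rewrite bx sandwichM // !mulrA dyd.
rewrite xb mulrBr mulr1 xn sandwichM // -sandwichB.
have -> : y ^+ n.+2 - y ^+ n.+2 * (y * d) = y ^+ 2 * (y ^+ n * (1 - y * d)).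
  by rewrite !mulrA -exprD mulrBr mulr1 mulrA.
by rewrite yn mulr0 /sandwich mulr0 mul0r.
Qed.

(** The Drazin inverse of [1 - x] is [e] and its spectral idempotent is [r]: [r]
    is killed by a power of [1 - x] because [w] is killed by a power of [1 - y],
    and on the complement of [r] the tail of the series of [(1 - x)^-1] is the
    image of [y^2 d]. *)
Lemma drazin_one_sub_mul_swap :
  drazin_invertible (1 - y) -> drazin_invertible (1 - x).
Proof.
move=> /drazin_invertibleP[d [n []]].
set s := 1 - y => sd dsd; set p := 1 - s * d => snp.
have ys : y = 1 - s by rewrite /s opprB addrC subrK.
have comm_s t : GRing.comm s t -> GRing.comm y t.
  by move=> st; rewrite ys; apply/commr_sym/commrB;
     [exact: commr1|exact: commr_sym].
have csp : GRing.comm s p by apply: commrB; [exact: commr1|exact: commrM].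
have pd : p * d = 0 by rewrite mulrBl mul1r sd dsd subrr.
have dp : d * p = 0 by rewrite mulrBr mulr1 mulrA dsd subrr.
have pp : p * p = p by rewrite {2}/p sd mulrBr mulr1 mulrA pd mul0r subr0.
have yd : GRing.comm y d by apply: comm_s.
have [w [csw ywE wp]] : exists w, [/\ GRing.comm s w, y * w = p & w * p = w].
  (* the inverse of y = 1 - s on the range of p, a finite geometric series *)
  exists ((\sum_(i < n) s ^+ i) * p); split; last by rewrite -mulrA pp.
    by apply: commrM => //; apply: commr_sum => i _; apply: commrX.
  have := subrX1 s n; rewrite -opprB -[s - 1]opprB mulNr => /oppr_inj.
  by rewrite -ys mulrA => <-; rewrite mulrBl mul1r snp subr0.
have yw : GRing.comm y w by apply: comm_s.
have pw : p * w = w by rewrite -ywE yw -mulrA ywE.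
have hw : comm_sq_multiple w.
  exists (w * w * w); first by do 2 apply: commrM => //.
  by rewrite expr2 -!mulrA (mulrA y w) ywE (mulrA p w) pw mulrA ywE pw.
have hy2 := comm_sq_multiple_sq.
have hyd : comm_sq_multiple (y ^+ 2 * d) by apply: comm_sq_multipleM.
have sub_l z : comm_sq_multiple z -> (1 - x) * sandwich z = sandwich (s * z).
  by move=> hz; rewrite !mulrBl !mul1r sandwichB mul_ba_sandwich.
have sub_r z : comm_sq_multiple z -> sandwich z * (1 - x) = sandwich (s * z).
  by move=> hz; rewrite mulrBr mulr1 mulrBl mul1r sandwichB sandwich_mul_ba.
have snw m : (1 - x) ^+ m * sandwich w = sandwich (s ^+ m * w).
  elim: m => [|m IH]; first by rewrite !expr0 !mul1r.
  rewrite exprS -mulrA IH sub_l ?exprS ?mulrA //.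
  have cm : GRing.comm w (s ^+ m) by apply/commrX/commr_sym.
  rewrite -cm; apply: comm_sq_multipleM => //.
  by apply: comm_s; apply: commrX.
pose r := sandwich w.
have rr : r * r = r by rewrite /r sandwichM // ywE wp.
have rx : r * x = x * r by rewrite /r sandwich_mul_ba // mul_ba_sandwich.
have x3r : x ^+ 3 * (1 - r) = sandwich (y ^+ 2 * (s * d)).
  rewrite ba_cube mulrBr mulr1 sandwichM // -sandwichB ywE.
  by rewrite mulrBr mulr1 opprB addrC subrK.
have syd : s * (y ^+ 2 * d) = y ^+ 2 * (s * d).
  have cm : GRing.comm s (y ^+ 2).
    by apply/commrX; rewrite ys; apply: commrB; [exact: commr1|].
  by rewrite mulrA cm -mulrA.
pose g := \sum_(i < 3) x ^+ i.
have gx : GRing.comm g (1 - x).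
  apply: commrB; first exact: commr1.
  by apply/commr_sym/commr_sum => i _; apply: commrX.
have geom : (1 - x) * g = 1 - x ^+ 3.
  by rewrite -opprB mulNr -subrX1 opprB.
pose e := g * (1 - r) + sandwich (y ^+ 2 * d).
have le : (1 - x) * e = 1 - r.
  rewrite mulrDr mulrA geom sub_l // syd -x3r -mulrDl subrK mul1r //.
have crx : (1 - r) * (1 - x) = (1 - x) * (1 - r).
  apply: commrB; first exact: commr1.
  by apply/commr_sym/commrB; [exact: commr1|].
have re : e * (1 - x) = 1 - r.
  by rewrite mulrDl -mulrA crx mulrA gx geom sub_r // syd -x3r -mulrDl subrK mul1r.
have er : e * r = 0.
  rewrite mulrDl -mulrA mulrBl mul1r rr subrr mulr0 add0r /r sandwichM //.
  by rewrite ywE -mulrA dp mulr0 /sandwich mulr0 mul0r.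
apply/drazin_invertibleP; exists e, n; split.
- by rewrite le re.
- by rewrite -mulrA le mulrBr mulr1 er subr0.
rewrite le subKr snw.
by rewrite -pw mulrA snp mul0r /sandwich mulr0 mul0r.
Qed.

End Transfer.

(** In the opposite ring [b a] is the product of [a] and [b], and [a c] that of
    [c] and [a]: exchanging [b] and [c] there reverses the implications. *)
Lemma drazin_mul_swap_iff (S : pzRingType) (a b c : S) :
  a * b * a * b * a = a * c * a * c * a ->
  a * b * a * c * a = a * c * a * c * a ->
  a * c * a * b * a = a * c * a * c * a ->
  (drazin_invertible (a * c) <-> drazin_invertible (b * a)) /\
  (drazin_invertible (1 - a * c) <-> drazin_invertible (1 - b * a)).
Proof.
move=> h1 h2 h3.
have words (T : pzRingType) (a' b' c' : T) :
    a' * b' * a' * b' * a' = a' * c' * a' * c' * a' ->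
    a' * b' * a' * c' * a' = a' * c' * a' * c' * a' ->
    a' * c' * a' * b' * a' = a' * c' * a' * c' * a' ->
    [/\ a' * b' * (a' * c') ^+ 2 = (a' * c') ^+ 3,
        (a' * c') ^+ 2 * a' * b' * a' = (a' * c') ^+ 3 * a' &
        (b' * a') ^+ 3 = b' * (a' * c') ^+ 2 * a'].
  move=> k1 k2 k3; split.
  - by rewrite !exprS expr0 !mulr1 !mulrA k2.
  - rewrite !exprS expr0 !mulr1 -!mulrA; congr (_ * (_ * _)).
    by move: k3; rewrite -!mulrA.
  - rewrite !exprS expr0 !mulr1 -!mulrA; congr (_ * _).
    by move: k1; rewrite -!mulrA.
have [w1 w2 w3] := words _ _ _ _ h1 h2 h3.
have k1 : (a : S^c) * c * a * c * a = (a : S^c) * b * a * b * a.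
  by change (a * (c * (a * (c * a))) = a * (b * (a * (b * a))));
     move: h1; rewrite -!mulrA.
have k2 : (a : S^c) * c * a * b * a = (a : S^c) * b * a * b * a.
  by change (a * (b * (a * (c * a))) = a * (b * (a * (b * a))));
     move: h1 h2; rewrite -!mulrA => -> ->.
have k3 : (a : S^c) * b * a * c * a = (a : S^c) * b * a * b * a.
  by change (a * (c * (a * (b * a))) = a * (b * (a * (b * a))));
     move: h1 h3; rewrite -!mulrA => -> ->.
have [v1 v2 v3] := words _ _ _ _ k1 k2 k3.
split; split.
- exact: drazin_mul_swap w1 w2 w3.
- move=> /drazin_invertible_converse dba; apply/drazin_invertible_converse.
  exact: drazin_mul_swap v1 v2 v3 dba.
- exact: drazin_one_sub_mul_swap w1 w2 w3.
- move=> /drazin_invertible_converse dba; apply/drazin_invertible_converse.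
  exact: drazin_one_sub_mul_swap v1 v2 v3 dba.
Qed.

(** * The Drazin spectrum *)

Section Spectrum.
Variables (K : numFieldType) (X : normedModType K).
Implicit Types T : boundedOp X.

(** Scalar operators are central, and those of nonzero scalars are invertible. *)
Lemma drazin_invertible_scaler (l : K) T :
  l != 0 -> drazin_invertible (l *: T) <-> drazin_invertible T.
Proof.
have central (k : K) T' : k *: (1 : boundedOp X) * T' = T' * (k *: (1 : boundedOp X)).
  by rewrite -boundedOp_scaleAl -boundedOp_scaleAr mul1r mulr1.
have scale (k : K) T' : k != 0 -> drazin_invertible T' -> drazin_invertible (k *: T').
  move=> k0 dT; rewrite -[T']mul1r boundedOp_scaleAl.
  apply: (@drazin_invertible_scale _ _ (k^-1 *: (1 : boundedOp X))) dT => //.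
  by rewrite -boundedOp_scaleAl mul1r scalerA mulfV // scale1r.
move=> l0; split; last exact: scale.
by move=> /(scale l^-1); rewrite scalerA mulVf // scale1r invr_eq0; apply.
Qed.

End Spectrum.

Theorem theorem3p5 (R : realType) (X : completeNormedModType R[i])
    (A B C : boundedOp X)
    (hBC : A * (B * A) ^+ 2 = A * B * A * C * A)
    (hcomm : A * B * A * C * A = A * C * A * B * A)
    (hC : A * C * A * B * A = (A * C) ^+ 2 * A) :
  drazin_spectrum (A * C) = drazin_spectrum (B * A).
Proof.
have h3 : A * C * A * B * A = A * C * A * C * A.
  by rewrite hC expr2 !mulrA.
have h2 : A * B * A * C * A = A * C * A * C * A by rewrite hcomm.
have h1 : A * B * A * B * A = A * C * A * C * A.
  by rewrite -h2 -hBC expr2 !mulrA.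
suff eqD (l : R[i]) : drazin_invertible (l *: (1 : boundedOp X) - A * C) <->
                      drazin_invertible (l *: (1 : boundedOp X) - B * A).
  by apply/seteqP; split=> l nD /eqD.
have [->|l0] := eqVneq l 0.
  rewrite scale0r !sub0r -(scaleN1r (A * C)) -(scaleN1r (B * A)).
  rewrite !drazin_invertible_scaler ?oppr_eq0 ?oner_eq0 //.
  by have [] := drazin_mul_swap_iff _ _ _ _ h1 h2 h3.
have scaled (D E : boundedOp X) : l^-1 *: A * D * (l^-1 *: A) * E * (l^-1 *: A) =
    l^-1 *: (l^-1 *: (l^-1 *: (A * D * A * E * A))).
  by rewrite -!boundedOp_scaleAl -!boundedOp_scaleAr -!boundedOp_scaleAl.
have [_] := drazin_mul_swap_iff _ (l^-1 *: A) B C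
  ltac:(by rewrite !scaled h1) ltac:(by rewrite !scaled h2)
  ltac:(by rewrite !scaled h3).
rewrite -(drazin_invertible_scaler _ _ _ _ l0).
rewrite -[X in _ <-> X](drazin_invertible_scaler _ _ _ _ l0).
by rewrite !scalerBr -boundedOp_scaleAl -boundedOp_scaleAr !scalerA mulfV // !scale1r.
Qed.
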